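(* There exists an $\varepsilon$-tester for connectedness of graphs (with no erasures), which is not given the average degree or number of edges of the input graph, that uses degree and neighbor queries, has 1-sided error, and has query and time complexity $O(\frac{1}{\varepsilon}\log\frac{1}{\varepsilon})$, for every $\varepsilon\in(0,1)$.
   Context: Graphs are simple undirected graphs on $n$ vertices with $m$ edges, represented by adjacency lists. A degree query on $v$ returns the degree of $v$; a neighbor query $(v,i)$ returns the $i$-th entry of the adjacency list of $v$. A graph is $\varepsilon$-far from connected if it differs in at least $\varepsilon m$ edges from every connected graph on the same vertex set. An $\varepsilon$-tester for connectedness accepts connected graphs with probability at least $2/3$ and rejects graphs $\varepsilon$-far from connected with probability at least $2/3$; 1-sided error means connected graphs are accepted with probability 1.
   Formalization: The logarithm is read as max(1, ln(1/ε)), since the bound literally tends to 0 as ε tends to 1, which no tester can meet; and rejection of ε-far graphs is required only for n ≥ 2, since the one-vertex graph is both connected and, with m = 0, literally ε-far. *)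

(* Defs.v *)
From mathcomp Require Import all_boot all_order all_algebra.
From mathcomp Require Import reals exp.
Set Implicit Arguments.
Unset Strict Implicit.
Unset Printing Implicit Defensive.
Import Order.TTheory GRing.Theory Num.Theory.
Local Open Scope ring_scope.

Record sgraph (n : nat) := SGraph {
  edge : rel 'I_n;
  edge_sym : symmetric edge;
  edge_irr : irreflexive edge }.

Section Graphs.
Variable n : nat.
Implicit Types G H : sgraph n.

Definition edge_set G : {set {set 'I_n}} :=
  [set [set u; v] | u in 'I_n, v in 'I_n & edge G u v].

Definition connected G : Prop := forall u v, connect (edge G) u v.

Definition edge_dist G H : nat :=
  #|(edge_set G :\: edge_set H) :|: (edge_set H :\: edge_set G)|.

Definition far_from_connected (R : realType) (eps : R) G : Prop :=
  forall H, connected H -> eps * #|edge_set G|%:R <= (edge_dist G H)%:R.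

(* The order of the neighbors in each list is arbitrary. *)
Definition adjacency_lists G (adj : 'I_n -> seq 'I_n) : Prop :=
  forall v, uniq (adj v) /\ adj v =i edge G v.

(* Vertices are named 0, ..., n - 1. Entries are numbered from 0, and the
   answer to a neighbor query outside the lists is n, which names no vertex. *)
Definition degree_query (adj : 'I_n -> seq 'I_n) (v : nat) : nat :=
  if insub v is Some u then size (adj u) else 0%N.

Definition neighbor_query (adj : 'I_n -> seq 'I_n) (v i : nat) : nat :=
  if insub v is Some u then nth n [seq val x | x <- adj u] i else n.

End Graphs.

(* Programs for a randomized word RAM with oracle access to a graph. Operands
   are addresses of memory cells; every instruction touches O(1) words.
     Const x k         M[x] := k
     Op o x y z        M[x] := M[y] o M[z]
     Read x y          M[x] := M[M[y]]
     Write x y         M[M[x]] := M[y]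
     Rand x y          M[x] := a uniform element of {0, ..., M[y] - 1}, 0 if M[y] = 0
     Degree x y        M[x] := degree of vertex M[y]
     Neighbor x y z    M[x] := entry M[z] of the adjacency list of M[y]
     If x c d, While x c branch on M[x] <> 0. *)
Inductive binop := Plus | Minus | Times | Quo | Rem | Less | Equal.

Inductive cmd :=
  | Const of nat & nat
  | Op of binop & nat & nat & nat
  | Read of nat & nat
  | Write of nat & nat
  | Rand of nat & nat
  | Degree of nat & nat
  | Neighbor of nat & nat & nat
  | Seq of cmd & cmd
  | If of nat & cmd & cmd
  | While of nat & cmd.

(* Subtraction is truncated at 0. *)
Definition eval_op (o : binop) (a b : nat) : nat :=
  match o with
  | Plus => a + b
  | Minus => a - b
  | Times => a * b
  | Quo => a %/ b
  | Rem => a %% b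
  | Less => (a < b)%N
  | Equal => a == b
  end%N.

(* todo is the stack of commands still to be run; queries counts the oracle
   queries made so far. *)
Record config := Config {
  todo : seq cmd;
  memory : nat -> nat;
  queries : nat }.

Definition halted (c : config) : bool := nilp (todo c).
Definition accepts (c : config) : bool := halted c && (memory c 0 != 0)%N.
Definition rejects (c : config) : bool := halted c && (memory c 0 == 0)%N.

Section Execution.
Variables (w n : nat) (adj : 'I_n -> seq 'I_n).

(* Words have w bits: whatever is written is reduced modulo 2 ^ w. *)
Definition write (m : nat -> nat) (a v : nat) : nat -> nat :=
  fun b => if b == a then (v %% 2 ^ w)%N else m b.

(* The possible configurations after one step, listed with multiplicity: each
   entry of the list is equally likely. All commands except Rand have exactly
   one successor, and a halted configuration stays as it is. *)
Definition successors (c : config) : seq config :=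
  let: Config s m q := c in
  if s is i :: k then
    match i with
    | Const x v => [:: Config k (write m x v) q]
    | Op o x y z => [:: Config k (write m x (eval_op o (m y) (m z))) q]
    | Read x y => [:: Config k (write m x (m (m y))) q]
    | Write x y => [:: Config k (write m (m x) (m y)) q]
    | Rand x y =>
        [seq Config k (write m x r) q | r <- iota 0 (maxn 1 (m y))]
    | Degree x y =>
        [:: Config k (write m x (degree_query adj (m y))) q.+1]
    | Neighbor x y z =>
        [:: Config k (write m x (neighbor_query adj (m y) (m z))) q.+1]
    | Seq a b => [:: Config (a :: b :: k) m q]
    | If x a b => [:: Config ((if m x != 0%N then a else b) :: k) m q]
    | While x a =>
        [:: Config (if m x != 0%N then a :: While x a :: k else k) m q]
    end
  else [:: c].

Fixpoint outcomes (t : nat) (c : config) : seq config :=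
  if t is t'.+1 then flatten [seq outcomes t' c' | c' <- successors c] else [:: c].

(* The probability that the configuration reached from c in t steps is in E. *)
Fixpoint prob (R : realType) (t : nat) (E : pred config) (c : config) : R :=
  if t is t'.+1 then
    (\sum_(c' <- successors c) prob R t' E c') / (size (successors c))%:R
  else (E c)%:R.

End Execution.

(* The real number eps, which does not fit in a word, is given to the machine
   as the integer ceil(1/eps). *)
Definition inv_ceil (R : realType) (eps : R) : nat := `|Num.ceil eps^-1|%N.

(* Cell 0 holds n, cell 1 holds ceil(1/eps), all other cells hold 0. In
   particular the number of edges is not part of the input. *)
Definition init (R : realType) (n : nat) (eps : R) (P : cmd) : config :=
  Config [:: P]
    (fun a => match a with 0 => n | 1 => inv_ceil eps | _ => 0 end)%N 0%N.

(* An instance for words of w bits: a graph on a nonempty vertex set, given by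
   adjacency lists, where w >= K * log2 (n + ceil(1/eps)), so that the usual
   O(log (n/eps))-bit words suffice. *)
Definition instance (R : realType) (eps : R) (K w n : nat) (G : sgraph n)
    (adj : 'I_n -> seq 'I_n) : Prop :=
  [/\ (0 < n)%N, adjacency_lists G adj
    & ((n + inv_ceil eps) ^ K <= 2 ^ w)%N].

(* Every run halts within t steps. Each query takes one step. *)
Definition time_complexity (R : realType) (eps : R) (K : nat) (P : cmd)
    (t : nat) : Prop :=
  forall w n (G : sgraph n) adj, instance eps K w G adj ->
    all halted (outcomes w adj t (init n eps P)).

Definition query_complexity (R : realType) (eps : R) (K : nat) (P : cmd)
    (q : nat) : Prop :=
  forall w n (G : sgraph n) adj, instance eps K w G adj ->
  forall t, all (fun c => queries c <= q)%N (outcomes w adj t (init n eps P)).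

(* t is a number of steps after which all runs have halted. The only graph on
   one vertex is connected and has no edge, hence it is also at distance at
   least eps * 0 from every connected graph: it is to be accepted. *)
Definition is_tester (R : realType) (eps : R) (K : nat) (P : cmd) (t : nat) :
    Prop :=
  forall w n (G : sgraph n) adj, instance eps K w G adj ->
    (connected G -> 2 / 3 <= prob w adj R t accepts (init n eps P)) /\
    ((1 < n)%N -> far_from_connected eps G ->
      2 / 3 <= prob w adj R t rejects (init n eps P)).

Definition one_sided (R : realType) (eps : R) (K : nat) (P : cmd) (t : nat) :
    Prop :=
  forall w n (G : sgraph n) adj, instance eps K w G adj ->
    connected G -> prob w adj R t accepts (init n eps P) = 1.

(* The logarithm is replaced by 1 where it is smaller, since (1/eps) ln (1/eps)
   tends to 0 when eps tends to 1. *)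
Definition complexity_scale (R : realType) (eps : R) : R :=
  eps^-1 * Num.max 1 (ln eps^-1).

(* Main.v *)
Require Import Defs.
From mathcomp Require Import all_boot all_order all_algebra.
From mathcomp Require Import reals exp.
From mathcomp Require Import zify ring lra.
Import Order.TTheory GRing.Theory Num.Theory.
Set Implicit Arguments.
Unset Strict Implicit.
Unset Printing Implicit Defensive.
Local Open Scope ring_scope.

(** Sample a uniform vertex u and a uniform r in {1, ..., M}, with M = 6k and
    k = ceil(1/eps), and search from u with the budget weight(u) M / r, where
    weight(u) = max(1, deg u) and visiting a vertex costs its weight. Reject if
    the search exhausts a component of fewer than n vertices; otherwise start
    again, until T = O(k log k) steps have been made.

    Write W for the total weight and c for the number of components. If W_C is
    the weight of the component C of u, the search succeeds with probability
    about weight(u) / W_C, and these ratios add up to c, so a sample succeeds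
    with probability about c/n. Its expected cost is about (W/n) H_M, because
    the budgets form a harmonic sum. Hence the expected total cost is about
    W H_M / c. If the graph is eps-far from connected, then c - 1 >= eps m, so
    W <= 2 m + c <= 3 k c, and the bound O(k log k) follows without any
    knowledge of the average degree. *)

(** * Probabilities of runs *)

Lemma all_flatten (T : Type) (P : pred T) ss :
  all P (flatten ss) = all (all P) ss.
Proof. by elim: ss => //= s ss IH; rewrite all_cat IH. Qed.

Section Runs.
Variables (w n : nat) (adj : 'I_n -> seq 'I_n).
Implicit Types (c : config) (t : nat).

Lemma size_successors_gt0 c : (0 < size (successors w adj c))%N.
Proof.
case: c => -[|[] *] //=; rewrite ?size_map ?size_iota //; lia.
Qed.

Lemma outcomes_halted t c : halted c -> outcomes w adj t c = [:: c].
Proof.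
by case: c => -[|//] m q _; elim: t => //= t ->.
Qed.

Lemma outcomes_add s t c :
  outcomes w adj (s + t) c =
  flatten [seq outcomes w adj t c' | c' <- outcomes w adj s c].
Proof.
elim: s c => [|s IH] c /=; first by rewrite cats0.
rewrite map_flatten -map_comp; elim: (successors _ _ _) => //= c' l ->.
by rewrite IH flatten_cat.
Qed.

Lemma outcomes_queries t c :
  all (fun c' => queries c' <= queries c + t)%N (outcomes w adj t c).
Proof.
elim: t c => [|t IH] c; first by rewrite /= addn0 leqnn.
have: all (fun c' => queries c' <= (queries c).+1)%N (successors w adj c).
  case: c => -[|[] *] *; rewrite /= ?all_map ?leqnn ?leqnSn //=.
  by apply/allP => r _ /=.
rewrite /= all_flatten all_map; apply: sub_all => c' q1 /=.
by apply: sub_all (IH c') => c''; lia.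
Qed.

(** A step makes at most one query, and halted configurations are fixed, so nothing is added to the
    count after [t0] steps. *)
Lemma halting_queries t0 c : all halted (outcomes w adj t0 c) ->
  forall t, all (fun c' => queries c' <= queries c + t0)%N (outcomes w adj t c).
Proof.
move=> ht t; case: (leqP t t0) => [le|/ltnW le].
  by apply: sub_all (outcomes_queries t c) => c'; lia.
rewrite -(subnKC le) outcomes_add all_flatten all_map.
have := outcomes_queries t0 c; elim: (outcomes _ _ _ _) ht => //= c' s IH.
by move=> /andP[hc hs] /andP[qc /(IH hs) ->]; rewrite outcomes_halted //= qc.
Qed.

Section Event.
Variables (R : realType) (E : pred config).
Local Notation pr := (prob w adj R).

Lemma prob_halted t c : halted c -> pr t E c = (E c)%:R.
Proof.
case: c => -[|//] m q _; elim: t => //= t IH.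
by rewrite big_seq1 divr1 IH.
Qed.

Lemma prob_le1 t c : pr t E c <= 1.
Proof.
elim: t c => [|t IH] c /=; first by rewrite lern1 leq_b1.
rewrite ler_pdivrMr ?ltr0n ?size_successors_gt0 // mul1r.
by rewrite -[X in _ <= X%:R]sum1_size natr_sum ler_sum.
Qed.

Lemma all_ge1_of_sum (T : Type) (f : T -> R) (s : seq T) :
  (forall i, f i <= 1) -> (size s)%:R <= \sum_(i <- s) f i ->
  all (fun i => 1 <= f i) s.
Proof.
move=> f1; have le_size s' : \sum_(i <- s') f i <= (size s')%:R.
  by rewrite -sum1_size natr_sum ler_sum.
elim: s => //= i s IH; rewrite big_cons -natr1 => le.
rewrite IH; last by move: (f1 i); lra.
by rewrite andbT; move: (le_size s); lra.
Qed.

(** An average of numbers at most 1 can reach 1 only if each of them does. This turns probability 1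
    into a statement about every run, so that termination is proved with the same rules as
    acceptance. *)
Lemma prob_ge1_all t c : 1 <= pr t E c -> all E (outcomes w adj t c).
Proof.
elim: t c => [|t IH] c /=; first by case: (E c) => //; rewrite ler10.
rewrite ler_pdivlMr ?ltr0n ?size_successors_gt0 // mul1r.
move=> /(all_ge1_of_sum (prob_le1 t)); rewrite all_flatten all_map.
exact: sub_all.
Qed.

(** Asking for the bound at all times from [t0] on lets branches of different lengths share one
    bound, without knowing that runs halt. *)
Definition prob_ge t0 (x : R) c := forall t, (t0 <= t)%N -> x <= pr t E c.

Lemma prob_geW t0 t1 x y c :
  (t0 <= t1)%N -> y <= x -> prob_ge t0 x c -> prob_ge t1 y c.
Proof.
by move=> le01 yx h t le; apply: le_trans yx (h _ _); apply: leq_trans le.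
Qed.

Lemma prob_ge_halted x c : halted c -> x <= (E c)%:R -> prob_ge 0 x c.
Proof. by move=> hc le t _; rewrite prob_halted. Qed.

Lemma prob_ge_step1 t0 x c c' :
  successors w adj c = [:: c'] -> prob_ge t0 x c' -> prob_ge t0.+1 x c.
Proof.
by move=> sc h [//|t] le /=; rewrite sc big_seq1 divr1; exact: h.
Qed.

Definition upd (m : nat -> nat) a v : nat -> nat :=
  fun b => if b == a then v else m b.

Lemma prob_ge_rand t0 x N a y (f : 'I_N -> R) k m q :
  m y = N -> (0 < N)%N -> (N <= 2 ^ w)%N -> x * N%:R <= \sum_r f r ->
  (forall r : 'I_N, prob_ge t0 (f r) (Config k (upd m a r) q)) ->
  prob_ge t0.+1 x (Config (Rand a y :: k) m q).
Proof.
move=> myN N0 Nw le h [//|t] let0 /=; rewrite myN (maxn_idPr N0).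
rewrite size_map size_iota ler_pdivlMr ?ltr0n //; apply: le_trans le _.
have -> : iota 0 N = index_iota 0 N by rewrite /index_iota subn0.
rewrite big_map big_mkord; apply: ler_sum => r _; have := h r t let0.
by rewrite /write modn_small // (leq_trans (ltn_ord r)).
Qed.

Lemma writeE m a v : (v < 2 ^ w)%N -> write w m a v = upd m a v.
Proof. by move=> lt; rewrite /write modn_small. Qed.

Variables (t0 : nat) (x : R) (k : seq cmd) (m : nat -> nat) (q : nat).
Local Notation ge t c := (prob_ge t x c).

Lemma prob_ge_const a v : (v < 2 ^ w)%N ->
  ge t0 (Config k (upd m a v) q) -> ge t0.+1 (Config (Const a v :: k) m q).
Proof. by move=> lt h; apply: prob_ge_step1 h; rewrite /= writeE. Qed.

(** The stored value [v] is a parameter, so that it enters the memory in simplified form;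
    [v < 2 ^ w] excludes wrap-around. The other rules with a computed value have the same shape. *)
Lemma prob_ge_op v o a y z : eval_op o (m y) (m z) = v -> (v < 2 ^ w)%N ->
  ge t0 (Config k (upd m a v) q) -> ge t0.+1 (Config (Op o a y z :: k) m q).
Proof. by move=> <- lt h; apply: prob_ge_step1 h; rewrite /= writeE. Qed.

Lemma prob_ge_read v a y : m (m y) = v -> (v < 2 ^ w)%N ->
  ge t0 (Config k (upd m a v) q) -> ge t0.+1 (Config (Read a y :: k) m q).
Proof. by move=> <- lt h; apply: prob_ge_step1 h; rewrite /= writeE. Qed.

Lemma prob_ge_write a v y z : m y = a -> m z = v -> (v < 2 ^ w)%N ->
  ge t0 (Config k (upd m a v) q) -> ge t0.+1 (Config (Write y z :: k) m q).
Proof. by move=> <- <- lt h; apply: prob_ge_step1 h; rewrite /= writeE. Qed.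

Lemma prob_ge_degree v a y : degree_query adj (m y) = v -> (v < 2 ^ w)%N ->
  ge t0 (Config k (upd m a v) q.+1) -> ge t0.+1 (Config (Degree a y :: k) m q).
Proof. by move=> <- lt h; apply: prob_ge_step1 h; rewrite /= writeE. Qed.

Lemma prob_ge_neighbor v a y z : neighbor_query adj (m y) (m z) = v ->
  (v < 2 ^ w)%N ->
  ge t0 (Config k (upd m a v) q.+1) ->
  ge t0.+1 (Config (Neighbor a y z :: k) m q).
Proof. by move=> <- lt h; apply: prob_ge_step1 h; rewrite /= writeE. Qed.

Lemma prob_ge_seq a b :
  ge t0 (Config (a :: b :: k) m q) -> ge t0.+1 (Config (Seq a b :: k) m q).
Proof. exact: prob_ge_step1. Qed.

Lemma prob_ge_if e a b y : m y = e ->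
  ge t0 (Config ((if e != 0%N then a else b) :: k) m q) ->
  ge t0.+1 (Config (If y a b :: k) m q).
Proof. by move=> <-; exact: prob_ge_step1. Qed.

Lemma prob_ge_while e a y : m y = e ->
  ge t0 (Config (if e != 0%N then a :: While y a :: k else k) m q) ->
  ge t0.+1 (Config (While y a :: k) m q).
Proof. by move=> <-; exact: prob_ge_step1. Qed.

End Event.
End Runs.

Local Notation "a ;; b" := (Seq a b) (at level 90, right associativity).

(** * The program *)

(* Cells: 0 is n, hence accepts unless cleared; 2 remaining steps; 3 whether a
   search is running; 4 its number, used as the mark of visited vertices;
   5 and 6 head and tail of the queue; 7 remaining budget; 10 current vertex;
   9 number of its neighbors still to be examined; 11, 12, 13 scratch;
   14 is 1; 15 is M; 16 is 32; 17 is 32 + n; 18 bit length of M. The mark of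
   vertex v is in cell 32 + v and the queue starts at cell 32 + n. *)
Definition skip : cmd := Const 13 0.

(** Visited means marked with the number of the current search. Older marks are smaller, so a new
    search needs no clearing of memory. Adjacency lists are read from the last entry down. *)
Definition scan_neighbor : cmd :=
  Op Minus 9 9 14 ;;
  Neighbor 12 10 9 ;;
  Op Plus 11 16 12 ;;
  Read 13 11 ;;
  Op Less 13 13 4 ;;
  If 13
    (Write 11 4 ;; Op Plus 11 17 6 ;; Write 11 12 ;; Op Plus 6 6 14)
    skip.

(** The weight max(1, deg) is computed as [deg < 1] + deg. *)
Definition pop_vertex : cmd :=
  Op Plus 11 17 5 ;;
  Read 10 11 ;;
  Op Plus 5 5 14 ;;
  Degree 9 10 ;;
  Op Less 11 9 14 ;;
  Op Plus 11 11 9 ;;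
  Op Less 12 7 11 ;;
  If 12 (Const 3 0) (Op Minus 7 7 11).

Definition component_done : cmd :=
  Const 3 0 ;;
  Op Less 13 6 0 ;;
  If 13 (Const 0 0 ;; Const 2 0) skip.

(** The draw in cell 13 lies in {0, ..., M - 1}, hence the increment before the division. The start
    vertex is queued here but charged to the budget only when popped. *)
Definition start_search : cmd :=
  Rand 10 0 ;;
  Rand 13 15 ;;
  Const 3 1 ;;
  Op Plus 4 4 14 ;;
  Degree 9 10 ;;
  Op Less 11 9 14 ;;
  Op Plus 11 11 9 ;;
  Op Times 11 11 15 ;;
  Op Plus 13 13 14 ;;
  Op Quo 7 11 13 ;;
  Const 9 0 ;;
  Const 5 0 ;;
  Const 6 1 ;;
  Op Plus 11 16 10 ;;
  Write 11 4 ;;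
  Write 17 10.

Definition body : cmd :=
  Op Minus 2 2 14 ;;
  If 3
    (If 9 scan_neighbor
       (Op Less 13 5 6 ;; If 13 pop_vertex component_done))
    start_search.

Definition prelude : cmd :=
  Const 14 1 ;;
  Const 15 6 ;;
  Op Times 15 15 1 ;;
  Const 11 2 ;;
  (* Cell 18 is still 0, so this copies M. *)
  Op Plus 12 15 18 ;;
  While 12 (Op Quo 12 12 11 ;; Op Plus 18 18 14) ;;
  (* The expected number of iterations will be at most 24 k l, with l the bit length of M; three
     times that leaves failure probability 1/3. *)
  Const 2 72 ;;
  Op Times 2 2 1 ;;
  Op Times 2 2 18 ;;
  Const 16 32 ;;
  Op Plus 17 16 0.

Definition tester : cmd := prelude ;; While 2 body.

Lemma leq_sum_uniq (T : finType) (F : T -> nat) (s : seq T) (C : {set T}) :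
  uniq s -> {subset s <= C} -> (\sum_(x <- s) F x <= \sum_(x in C) F x)%N.
Proof.
move=> us sC; rewrite big_uniq //= [leqRHS](bigID (mem s)) /=.
apply: leq_trans (leq_addr _ _); apply/eq_leq/eq_bigl => x.
by rewrite /= andbC; case: (boolP (x \in s)) => //= /sC ->.
Qed.

(** * Markov's inequality *)

Section MarkovBound.
Variable R : realType.

(* The lower bound that Markov's inequality gives on the probability that an
   expected cost of V fits into a budget of T. *)
Definition markov (V T : nat) : R :=
  if (T <= V)%N then 0 else 1 - V%:R / T%:R.

Lemma markovE V T : (V < T)%N -> markov V T = 1 - V%:R / T%:R.
Proof. by rewrite /markov ltnNge => /negPf ->. Qed.

Lemma markov_ge0 V T : 0 <= markov V T.
Proof.
rewrite /markov; case: leqP => // lt.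
rewrite subr_ge0 ler_pdivrMr ?ltr0n; last by lia.
by rewrite mul1r ler_nat ltnW.
Qed.

Lemma markov_le1 V T : markov V T <= 1.
Proof. by rewrite /markov; case: leqP => // _; rewrite gerBl divr_ge0. Qed.

Lemma markov_anti V V' T : (V <= V')%N -> markov V' T <= markov V T.
Proof.
move=> le; rewrite {1}/markov; case: leqP => [_|lt]; first exact: markov_ge0.
rewrite markovE ?(leq_ltn_trans le) // lerD2l lerN2 ler_pM2r ?ler_nat //.
by rewrite invr_gt0 ltr0n; lia.
Qed.

Lemma markov_step V T : markov V.+1 T.+1 <= markov V T.
Proof.
rewrite {1}/markov ltnS; case: leqP => [_|lt]; first exact: markov_ge0.
rewrite markovE // lerD2l lerN2 ler_pdivrMr ?ltr0n; last lia.
rewrite mulrAC ler_pdivlMr ?ltr0n // -!natrM ler_nat; lia.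
Qed.

(** The loss is min(1, V / T), which is at most (V + 1) / (T + 1) if V < T. *)
Lemma markov_loss V T : (1 - markov V T) * T.+1%:R <= V.+1%:R.
Proof.
rewrite /markov; case: leqP => lt; first by rewrite subr0 mul1r ler_nat.
rewrite opprB addrC subrK mulrAC ler_pdivrMr ?ltr0n; last lia.
rewrite -!natrM ler_nat; lia.
Qed.

(** One iteration draws the pair (u, r) and leaves an expected cost [V u r]. If the mean of the
    total cost is at most D, summing [markov_loss] over all pairs gives the Markov bound for D. *)
Lemma markov_average (n M : nat) (V : 'I_n -> 'I_M -> nat) D T :
  (\sum_u \sum_r (V u r).+1 <= n * M * D)%N ->
  markov D T.+1 * (n * M)%:R <= \sum_u \sum_r markov (V u r) T.
Proof.
move=> le; case: (leqP T.+1 D) => [le'|lt].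
  rewrite [X in X * _]/markov le' mul0r.
  by do 2 apply: sumr_ge0 => ? _; exact: markov_ge0.
rewrite markovE //; have Tpos : 0 < T.+1%:R :> R by rewrite ltr0n.
have loss : (\sum_u \sum_r (1 - markov (V u r) T)) * T.+1%:R
    <= (n * M * D)%:R.
  apply: (@le_trans _ _ ((\sum_u \sum_r (V u r).+1)%N%:R)); last first.
    by rewrite ler_nat.
  rewrite natr_sum mulr_suml; apply: ler_sum => u _.
  rewrite natr_sum mulr_suml; apply: ler_sum => r _; exact: markov_loss.
have sumE : \sum_u \sum_r (1 - markov (V u r) T)
    = (n * M)%:R - \sum_u \sum_r markov (V u r) T.
  have -> : (n * M)%:R = \sum_(u < n) \sum_(r < M) (1 : R).
    by rewrite !sumr_const !card_ord -mulrnA mulnC.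
  rewrite -sumrB; apply: eq_bigr => u _; by rewrite -sumrB.
move: loss; rewrite sumE -ler_pdivlMr // (natrM _ (n * M)%N) -mulrA.
rewrite mulrBl mul1r.
by rewrite [_ * (n * M)%:R]mulrC !lerBlDr addrC.
Qed.
End MarkovBound.

(* Evaluates reads from updated memories, the equality of addresses being
   decided by lia. *)
Local Ltac mem := rewrite /upd /=; repeat (case: eqP => [?|?] //=); try lia.
Local Ltac side := rewrite /upd /=; first [lia | mem | idtac].
Local Ltac seqs := repeat apply: prob_ge_seq.
Local Ltac op u := seqs; apply: (prob_ge_op (v := u)); [side | side |].

(** * The main loop *)

Section Loop.
Variables (w n : nat) (adj : 'I_n -> seq 'I_n).
Hypothesis adj_uniq : forall v, uniq (adj v).
Variables (M T0 : nat).
Hypotheses (n_gt0 : (0 < n)%N) (M_gt0 : (0 < M)%N).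
Hypotheses (T0w : (T0 < 2 ^ w)%N) (nMw : (n * M < 2 ^ w)%N)
  (addrw : (32 + (n + n) < 2 ^ w)%N).

Definition weight (v : 'I_n) : nat := maxn 1 (size (adj v)).

(* The search has reached the vertices in the queue Q, the first h of which
   have been popped; the first rem neighbors of the last popped one, v, are
   still to be examined, and B is what is left of the budget. *)
Inductive state :=
  | Idle
  | Busy (Q : seq 'I_n) (h B : nat) (v : 'I_n) (rem : nat).

Definition represents_search (m : nat -> nat) (s : state) : Prop :=
  match s with
  | Idle => m 3 = 0
  | Busy Q h B v rem =>
    [/\ [/\ m 3 = 1, m 5 = h & m 6 = size Q],
        [/\ m 7 = B, m 9 = rem, m 10 = v & (B < 2 ^ w)%N],
        [/\ uniq Q, (h <= size Q)%N & (rem <= size (adj v))%N],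
        forall j, (j < size Q)%N ->
          m (32 + n + j) = nth n [seq val x | x <- Q] j
      & forall u : 'I_n, m (32 + u) = m 4 <-> u \in Q]%N
  end.

(** Marks never exceed the search number in cell 4, so incrementing it unmarks all vertices at once.
    Each search uses up an iteration, hence T + m 4 stays at most [T0] and marks fit in a word. *)
Definition represents (m : nat -> nat) (T : nat) (s : state) : Prop :=
  [/\ [/\ m 0 = n, m 14 = 1, m 15 = M, m 16 = 32 & m 17 = 32 + n],
      m 2 = T, (T + m 4 <= T0)%N,
      forall u : 'I_n, (m (32 + u) <= m 4)%N
    & represents_search m s]%N.

Section Event.
Variables (R : realType) (E : pred config).

(* An iteration takes at most 40 steps. *)
Definition loop_ge (T : nat) (s : state) (x : R) : Prop :=
  forall m q, represents m T s ->
    prob_ge w adj E (40 * T).+1 x (Config [:: While 2 body] m q).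

Lemma loop_ge_end s x :
  (forall m q, m 0 = n -> x <= (E (Config [::] m q))%:R) -> loop_ge 0 s x.
Proof.
move=> h m q [[m0 _ _ _ _] m2 _ _ _].
apply: (prob_ge_while m2) => /=.
by apply: prob_ge_halted => //; apply: h.
Qed.

Lemma leq_adj (v : 'I_n) : (size (adj v) <= n)%N.
Proof. by rewrite -[leqRHS]card_ord -(card_uniqP (adj_uniq v)) max_card. Qed.

Lemma neighbor_queryE (v : 'I_n) i u0 : (i < size (adj v))%N ->
  neighbor_query adj v i = nth u0 (adj v) i.
Proof.
move=> lt; rewrite /neighbor_query insubT //= => vn.
have -> : Sub (val v) vn = v by apply: val_inj.
by rewrite (nth_map u0).
Qed.

Lemma degree_queryE (v : 'I_n) : degree_query adj v = size (adj v).
Proof.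
rewrite /degree_query insubT //= => vn.
by have -> : Sub (val v) vn = v by apply: val_inj.
Qed.

Definition enqueue (Q : seq 'I_n) y : seq 'I_n :=
  if y \in Q then Q else rcons Q y.


Lemma enqueue_uniq Q y : uniq Q -> uniq (enqueue Q y).
Proof. by rewrite /enqueue; case: ifP => // yQ; rewrite rcons_uniq yQ. Qed.

Lemma mem_enqueue Q y u : (u \in enqueue Q y) = (u == y) || (u \in Q).
Proof.
rewrite /enqueue; case: ifP => [yQ|_]; last by rewrite mem_rcons inE.
by case: eqP => [->|].
Qed.

Lemma uniq_size_ord (Q : seq 'I_n) : uniq Q -> (size Q <= n)%N.
Proof. by move=> /card_uniqP <-; rewrite -[leqRHS]card_ord max_card. Qed.

Lemma loop_ge_scan T (Q : seq 'I_n) h B v rem x :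
  loop_ge T (Busy (enqueue Q (nth v (adj v) rem)) h B v rem) x ->
  loop_ge T.+1 (Busy Q h B v rem.+1) x.
Proof.
move=> next m q [[m0 m14 m15 m16 m17] m2 mT marks].
case=> -[m3 m5 m6] [m7 m9 m10 Bw] [uQ hQ remv] queue inQ.
set y := nth v (adj v) rem in next *.
have yn := ltn_ord y; have vn := ltn_ord v; have degn := leq_adj v.
have uQy := enqueue_uniq y uQ; have sQy := uniq_size_ord uQy.
have my := marks y.
(* The literal 39 provides successors for the instruction rules to consume; what is left over is
   dropped when [next] is applied. *)
apply: (@prob_geW _ _ _ _ _ (39 + (40 * T).+1)%N _ x) => //; first lia.
apply: (prob_ge_while m2) => /=.
op T.
apply: (prob_ge_if (e := 1)) => //=.
apply: (prob_ge_if (e := rem.+1)) => //=.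
op rem.
seqs; apply: (prob_ge_neighbor (v := y)).
  by rewrite /upd /= m10 (neighbor_queryE v).
  lia.
op (32 + y)%N.
seqs; apply: (prob_ge_read (v := m (32 + y)%N)); [by mem | lia |].
have unmarked : (m (32 + y) < m 4 = (y \notin Q))%N.
  by rewrite ltn_neqAle my andbT; congr negb; apply/eqP/idP => /inQ.
op (y \notin Q : nat); first by rewrite unmarked.
apply: (prob_ge_if (e := (y \notin Q : nat))) => //.
case: (boolP (y \in Q)) => yQ /=.
  apply: (prob_ge_const (v := 0%N)); first lia.
  apply: prob_geW (next _ _ _) => //; first lia.
  have -> : enqueue Q y = Q by rewrite /enqueue yQ.
  split; [by []|by []|by side| |].
    by move=> u; mem; apply: marks.
  split; [by []|by split => //=; side|by split => //; lia| |].
    by move=> j lt; mem; exact: queue.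
  by move=> u; mem; exact: inQ.
have sQ : (size Q < n)%N.
  by move: sQy; rewrite /enqueue (negPf yQ) size_rcons.
seqs; apply: (prob_ge_write (a := (32 + y)%N) (v := m 4%N)) => //; first lia.
op (32 + n + size Q)%N.
seqs; apply: (prob_ge_write (a := (32 + n + size Q)%N) (v := y)).
- by [].
- by mem.
- by lia.
op (size Q).+1.
apply: prob_geW (next _ _ _) => //; first lia.
split; [by split; mem|by mem|by mem| |].
  by move=> u; have := ltn_ord u; mem; apply: marks.
have eQ : enqueue Q y = rcons Q y by rewrite /enqueue (negPf yQ).
split.
- by split; mem; rewrite eQ size_rcons.
- by split => //; mem.
- by split => //; rewrite ?eQ ?size_rcons; lia.
- move=> j; rewrite eQ size_rcons map_rcons nth_rcons size_map => lt.
  mem; case: ltngtP; try lia; first by move=> /queue.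
- move=> u; rewrite mem_enqueue; have := ltn_ord u; have := inQ u.
  case: (u =P y) => [->|ne]; mem; last first.
    by case: ne; apply: val_inj => /=; lia.
Qed.

Lemma loop_ge_pop T (Q : seq 'I_n) h B v x : (h < size Q)%N ->
  let u := nth v Q h in
  loop_ge T (if (weight u <= B)%N
             then Busy Q h.+1 (B - weight u) u (size (adj u)) else Idle) x ->
  loop_ge T.+1 (Busy Q h B v 0) x.
Proof.
move=> lth u next m q [[m0 m14 m15 m16 m17] m2 mT marks].
case=> -[m3 m5 m6] [m7 m9 m10 Bw] [uQ hQ remv] queue inQ.
have un := ltn_ord u; have vn := ltn_ord v; have degn := leq_adj u.
have sQ := uniq_size_ord uQ.
have wuE : weight u = ((size (adj u) < 1) + size (adj u))%N.
  by rewrite /weight; lia.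
apply: (@prob_geW _ _ _ _ _ (39 + (40 * T).+1)%N _ x) => //; first lia.
apply: (prob_ge_while m2) => /=.
op T.
apply: (prob_ge_if (e := 1)) => //=.
apply: (prob_ge_if (e := 0)) => //=.
op 1%N.
apply: (prob_ge_if (e := 1)) => //=.
op (32 + n + h)%N.
seqs; apply: (prob_ge_read (v := u)).
- by mem; rewrite queue // (nth_map v).
- by lia.
op h.+1.
seqs; apply: (prob_ge_degree (v := size (adj u))).
- by rewrite /upd /= degree_queryE.
- by lia.
op (size (adj u) < 1 : nat)%N.
op (weight u).
op (B < weight u : nat)%N.
apply: (prob_ge_if (e := (B < weight u : nat)%N)) => //.
move: next; case: leqP => leB next /=; last first.
  apply: (prob_ge_const (v := 0%N)); first lia.
  apply: prob_geW (next _ _ _) => //; first lia.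
  split; [by []|by []|by side| |by []].
  by move=> y; mem; apply: marks.
op (B - weight u)%N.
apply: prob_geW (next _ _ _) => //; first lia.
split; [by split; mem|by mem|by mem| |].
  by move=> y; mem; apply: marks.
split; [by []|by split => //; mem|by []| |].
  by move=> j lt; mem; exact: queue.
by move=> y; have := inQ y; mem.
Qed.

Lemma loop_ge_done T (Q : seq 'I_n) B v (x : R) :
  ((size Q < n)%N ->
    forall m q, m 0%N = 0%N -> x <= (E (Config [::] m q))%:R) ->
  ((n <= size Q)%N -> loop_ge T Idle x) ->
  loop_ge T.+1 (Busy Q (size Q) B v 0) x.
Proof.
move=> rej next m q [[m0 m14 m15 m16 m17] m2 mT marks].
case=> -[m3 m5 m6] [m7 m9 m10 Bw] [uQ hQ remv] queue inQ.
have sQ := uniq_size_ord uQ.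
apply: (@prob_geW _ _ _ _ _ (39 + (40 * T).+1)%N _ x) => //; first lia.
apply: (prob_ge_while m2) => /=.
op T.
apply: (prob_ge_if (e := 1)) => //=.
apply: (prob_ge_if (e := 0)) => //=.
op 0%N.
apply: (prob_ge_if (e := 0)) => //=.
seqs; apply: (prob_ge_const (v := 0%N)); first lia.
op (size Q < n : nat)%N.
apply: (prob_ge_if (e := (size Q < n : nat)%N)) => //.
move: next rej; case: ltnP => ltQ next rej /=.
  seqs; apply: (prob_ge_const (v := 0%N)); first lia.
  apply: (prob_ge_const (v := 0%N)); first lia.
  apply: (prob_ge_while (e := 0)) => //=.
  apply: (prob_geW (t0 := 0) (x := x)) => //.
  by apply: prob_ge_halted => //; apply: rej.
apply: (prob_ge_const (v := 0%N)); first lia.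
apply: prob_geW (next _ _ _ _) => //; first lia.
split; [by []|by []|by side| |by []].
by move=> y; mem; apply: marks.
Qed.

Lemma loop_ge_start T (x : R) (f : 'I_n -> 'I_M -> R) :
  x * (n * M)%:R <= \sum_u \sum_r f u r ->
  (forall u (r : 'I_M),
    loop_ge T (Busy [:: u] 0 (weight u * M %/ r.+1) u 0) (f u r)) ->
  loop_ge T.+1 Idle x.
Proof.
move=> le next m q [[m0 m14 m15 m16 m17] m2 mT marks] m3.
have Mpos : 0 < M%:R :> R by rewrite ltr0n.
have Mn : (M <= n * M)%N by rewrite leq_pmull.
apply: (@prob_geW _ _ _ _ _ (39 + (40 * T).+1)%N _ x) => //; first lia.
apply: (prob_ge_while m2) => /=.
op T.
apply: (prob_ge_if (e := 0)) => //=.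
(* Once u is drawn, the bound is the mean of [f u] over the draw of r still to come. *)
seqs; apply: (prob_ge_rand (N := n)
  (f := fun u => (\sum_r f u r) / M%:R)) => //; first lia.
  by rewrite -mulr_suml ler_pdivlMr // -mulrA -natrM.
move=> u; have un := ltn_ord u; have degn := leq_adj u.
have wuE : weight u = ((size (adj u) < 1) + size (adj u))%N.
  by rewrite /weight; lia.
have wn : (weight u <= n)%N by rewrite geq_max n_gt0.
have wM : (weight u * M <= n * M)%N by rewrite leq_mul2r wn orbT.
seqs; apply: (prob_ge_rand (N := M) (f := f u)) => //; first lia.
  by rewrite divfK // gt_eqF.
move=> r; have rM := ltn_ord r.
have BwM : (weight u * M %/ r.+1 <= weight u * M)%N by exact: leq_div.
seqs; apply: (prob_ge_const (v := 1%N)); first lia.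
op (m 4%N).+1.
seqs; apply: (prob_ge_degree (v := size (adj u))).
- by rewrite /upd /= degree_queryE.
- by lia.
op (size (adj u) < 1 : nat)%N.
op (weight u).
op (weight u * M)%N.
op r.+1.
op (weight u * M %/ r.+1)%N.
do 2 (seqs; apply: (prob_ge_const (v := 0%N)); first lia).
seqs; apply: (prob_ge_const (v := 1%N)); first lia.
op (32 + u)%N.
seqs; apply: (prob_ge_write (a := (32 + u)%N) (v := (m 4%N).+1)).
- by [].
- by [].
- by lia.
apply: (prob_ge_write (a := (32 + n)%N) (v := u)).
- by mem.
- by mem.
- by lia.
apply: (@prob_geW _ _ _ _ _ (40 * T).+1 _ (f u r)) => //; [lia|apply: next].
split; [by split; mem|by mem|by mem| |].
  by move=> y; have yn := ltn_ord y; have := marks y; mem.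
split; [by split; mem|by split; mem|by []| |].
  by move=> [|//] _; mem.
move=> y; have yn := ltn_ord y; have := marks y; rewrite inE.
case: (y =P u) => [->|ne]; mem.
by case: ne; apply: val_inj => /=; lia.
Qed.

End Event.

(** * Halting, acceptance and rejection of the main loop *)

Section Analysis.
Variable R : realType.

Lemma loop_geW E T s (x y : R) : y <= x -> loop_ge E T s x -> loop_ge E T s y.
Proof. by move=> le h m q rep; apply: prob_geW (h m q rep). Qed.

(** Gives access to the invariants on the queue without unfolding the memory. *)
Lemma loop_ge_busy E T Q h B v rem (x : R) :
  (uniq Q -> (h <= size Q)%N -> (rem <= size (adj v))%N ->
     loop_ge E T (Busy Q h B v rem) x) ->
  loop_ge E T (Busy Q h B v rem) x.
Proof.
move=> hyp m q rep; case: (rep) => _ _ _ _ [_ _ [? ? ?] _ _].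
exact: hyp.
Qed.

Lemma loop_halts T s : loop_ge halted T s (1 : R).
Proof.
elim: T s => [|T IH] s; first exact: loop_ge_end.
case: s => [|Q h B v [|rem]]; last by apply: loop_ge_scan.
  apply: (loop_ge_start (f := fun _ _ => 1)) => [|u r]; last exact: IH.
  by rewrite !sumr_const !card_ord -mulrnA mulnC mul1r.
apply: loop_ge_busy => _ hQ _; move: hQ; rewrite leq_eqVlt => /orP[/eqP ->|lt].
  exact: loop_ge_done.
by apply: loop_ge_pop => //; exact: IH.
Qed.

(** Every neighbor of a popped vertex is in the queue or among the entries of [adj v] still to be
    scanned. With an exhausted queue and [rem] = 0, this says that Q is closed under adjacency. *)
Definition explored (s : state) : Prop :=
  if s is Busy Q h B v rem then
    (0 < size Q)%N /\ forall u y, u \in take h Q -> y \in adj u ->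
      (y \in Q) || (y \in take rem (adj v))
  else True.

(** An exhausted queue is nonempty and closed, hence contains all vertices, and the rejecting branch
    is never taken. *)
Lemma loop_accepts T s :
  (forall Q, (0 < size Q)%N -> (forall u y, u \in Q -> y \in adj u -> y \in Q) ->
     forall u, u \in Q) ->
  explored s -> loop_ge accepts T s (1 : R).
Proof.
move=> conn; elim: T s => [|T IH] s.
  by move=> _; apply: loop_ge_end => m q m0; rewrite /accepts /= m0 -lt0n n_gt0.
case: s => [_|Q h B v rem [Q0 closedQ]].
  apply: (loop_ge_start (f := fun _ _ => 1)) => [|u r]; last first.
    by apply: IH; split=> // ? ?; rewrite take0.
  by rewrite !sumr_const !card_ord -mulrnA mulnC mul1r.
apply: loop_ge_busy => uQ hQ; case: rem closedQ => [|rem] closedQ remv.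
  move: hQ; rewrite leq_eqVlt => /orP[/eqP hE|lt].
    rewrite hE; apply: loop_ge_done => [|_]; last exact: IH.
    rewrite -[X in (_ < X)%N]card_ord ltnNge => /negP[].
    rewrite -(card_uniqP uQ) subset_leq_card //; apply/subsetP => u _.
    apply: conn => // z y; have := closedQ z y.
    by rewrite hE take_size take0 orbF.
  apply: loop_ge_pop => //; case: ifP => _; apply: IH => //; split=> // z y.
  rewrite (take_nth v) // mem_rcons inE take_size => /orP[/eqP -> ->|zQ yz].
    by rewrite orbT.
  by have := closedQ z y zQ yz; rewrite take0 orbF => ->.
apply: loop_ge_scan; apply: IH; split.
  by rewrite /enqueue; case: ifP => // _; rewrite size_rcons.
move=> z y zQ yz; rewrite mem_enqueue.
have {zQ} zQ : z \in take h Q.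
  by move: zQ; rewrite /enqueue; case: ifP => // _; rewrite -cats1 takel_cat.
have := closedQ z y zQ yz.
by rewrite (take_nth v) // mem_rcons inE orbCA orbA.
Qed.

Section Reject.
Variable C : 'I_n -> {set 'I_n}.
Hypothesis C_refl : forall u, u \in C u.
Hypothesis C_closed : forall u x y, x \in C u -> y \in adj x -> y \in C u.
Hypothesis C_proper : forall u, (#|C u| < n)%N.

Local Notation W u := (\sum_(x : 'I_n | x \in C u) weight x)%N.


(** The budget covers the weight of C u not yet paid for, so the search is never abandoned. Each
    iteration lowers 2 B + rem: popping z takes 2 [weight z] from 2 B and adds at most [weight z] to
    rem. The extra 1 pays for the final test. *)
Lemma loop_rejects_within T u (Q : seq 'I_n) h B v rem :
  v \in Q -> {subset Q <= C u} ->
  (W u <= B + \sum_(x <- take h Q) weight x)%N ->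
  loop_ge rejects T (Busy Q h B v rem) (markov R (2 * B + rem).+1 T).
Proof.
elim: T Q h B v rem => [|T IH] Q h B v rem vQ QC le.
  by apply: loop_ge_end => m q _; rewrite /markov /= ler0n.
apply: loop_ge_busy => uQ hQ; case: rem => [|rem] remv.
  move: hQ; rewrite leq_eqVlt => /orP[/eqP hE|lt].
    rewrite hE; apply: loop_ge_done => [_ m q m0|].
      by rewrite /rejects /= m0; exact: markov_le1.
    move=> leQ; have := C_proper u; rewrite ltnNge => /negP[].
    apply: leq_trans leQ _; rewrite -(card_uniqP uQ) subset_leq_card //.
    exact/subsetP.
  apply: loop_ge_pop => //; set z := nth v Q h.
  have zQ : z \in Q by rewrite mem_nth.
  have leW : (\sum_(x <- take h.+1 Q) weight x <= W u)%N.
    apply: leq_sum_uniq; first exact: take_uniq.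
    by move=> x /mem_take /QC.
  move: leW; rewrite (take_nth v) // big_rcons /= -/z => leW.
  have wB : (weight z <= B)%N.
    rewrite -(leq_add2l (\sum_(x <- take h Q) weight x)%N) [leqRHS]addnC.
    exact: leq_trans leW le.
  rewrite wB; apply: loop_geW (IH _ _ _ _ _ _ _ _) => //.
    apply: le_trans (markov_step _ _ _); apply: markov_anti.
    by move: wB; rewrite /weight; lia.
  rewrite (take_nth v) // big_rcons /= -/z.
  by rewrite [X in (_ <= _ + X)%N]addnC addnA subnK.
have yC : nth v (adj v) rem \in C u.
  by apply: (C_closed (QC _ vQ)); rewrite mem_nth.
apply: loop_ge_scan; apply: loop_geW (IH _ _ _ _ _ _ _ _).
- by rewrite addnS; exact: markov_step.
- by rewrite mem_enqueue vQ orbT.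
- by move=> x; rewrite mem_enqueue => /orP[/eqP -> //|/QC].
- rewrite /enqueue; case: ifP => // _; by rewrite -cats1 takel_cat.
Qed.

Variable D : nat.
Local Notation budget u r := (weight u * M %/ (r : 'I_M).+1)%N.
Hypothesis D_large :
  (2 * (\sum_u \sum_r budget u r) + 2 * (n * M)
   <= D * \sum_u \sum_r (W u <= budget u r))%N.

(* An upper bound on the expected number of steps before rejection. *)
Definition potential (s : state) : nat :=
  if s is Busy Q h B v rem then (2 * B + rem).+1 + D else D.

(** A trial, with its draw, costs at most 2 budget + 2 iterations, and D more if the budget does not
    cover the component. Divided by n M, [D_large] says that D bounds the mean of this cost. *)
Lemma loop_rejects T s : loop_ge rejects T s (markov R (potential s) T).
Proof.
elim: T s => [|T IH] s.
  by apply: loop_ge_end => m q _; rewrite /markov /= ler0n.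
case: s => [|Q h B v rem].
  have split_D (b : bool) : (D * b + (if b then 0 else D) <= D)%N.
    by case: b; lia.
  pose V u r :=
    ((2 * budget u r).+1 + (if (W u <= budget u r)%N then 0 else D))%N.
  apply: (loop_ge_start (f := fun u r => markov R (V u r) T)) => [|u r].
    apply: markov_average => /=.
    have -> : (\sum_u \sum_r (V u r).+1 =
        2 * (\sum_u \sum_r budget u r) + 2 * (n * M) +
        \sum_u \sum_r (if (W u <= budget u r)%N then 0 else D))%N.
      rewrite big_distrr /=.
      have -> : (2 * (n * M) = \sum_(u < n) \sum_(r < M) 2)%N.
        by rewrite !sum_nat_const !card_ord; lia.
      rewrite -!big_split /=; apply: eq_bigr => u _.
      rewrite big_distrr /= -!big_split /=; apply: eq_bigr => r _.
      by rewrite /V; case: ifP => _; lia.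
    apply: leq_trans (_ : (D * (\sum_u \sum_r (W u <= budget u r)) +
       \sum_u \sum_r (if (W u <= budget u r)%N then 0 else D) <= _)%N).
      by rewrite leq_add2r.
    have -> : (n * M * D = \sum_(u < n) \sum_(r < M) D)%N.
      by rewrite !sum_nat_const !card_ord mulnA.
    rewrite big_distrr -big_split; apply: leq_sum => u _ /=.
    rewrite big_distrr -big_split; apply: leq_sum => r _ /=.
    exact: split_D.
  (* A sufficient budget makes rejection certain, without the extra D; otherwise the induction
     hypothesis accounts for a restart. *)
  rewrite /V; case: leqP => leW; last first.
    by apply: loop_geW (IH _); rewrite /= addn0.
  rewrite addn0 -(addn0 (2 * _)%N); apply: (@loop_rejects_within _ u).
  - by rewrite inE.
  - by move=> x; rewrite inE => /eqP ->.
  - by rewrite take0 big_nil addn0.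
apply: loop_ge_busy => uQ hQ; case: rem => [|rem] remv.
  move: hQ; rewrite leq_eqVlt => /orP[/eqP hE|lt].
    rewrite hE; apply: loop_ge_done => [_ m q m0|_].
      by rewrite /rejects /= m0; exact: markov_le1.
    apply: loop_geW (IH _); apply: le_trans (markov_step _ _ _).
    by apply: markov_anti => /=; lia.
  apply: loop_ge_pop => //; case: ifP => leB; apply: loop_geW (IH _);
    apply: le_trans (markov_step _ _ _); apply: markov_anti => /=; last lia.
  by move: leB; rewrite /weight; lia.
apply: loop_ge_scan; apply: loop_geW (IH _).
by apply: le_trans (markov_step _ _ _); apply: markov_anti => /=; lia.
Qed.

End Reject.
End Analysis.
End Loop.

(** * Counting components *)

Section Combinatorics.
Local Open Scope nat_scope.

(** Dyadic bound on the harmonic sum: the 2 ^ l terms with 2 ^ l <= r < 2 ^ (l + 1) are at most x /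
    2 ^ l each, so the block contributes at most x. *)
Lemma sum_divn_dyadic x l : \sum_(1 <= r < 2 ^ l) x %/ r <= x * l.
Proof.
elim: l => [|l IH]; first by rewrite big_geq.
have p0 : 0 < 2 ^ l by rewrite expn_gt0.
rewrite (@big_cat_nat _ _ _ (2 ^ l)) //=; last by rewrite leq_exp2l.
rewrite mulnS addnC leq_add //.
apply: (@leq_trans (\sum_(2 ^ l <= r < 2 ^ l.+1) x %/ 2 ^ l)).
  rewrite !big_nat; apply: leq_sum => r /andP[le _]; exact: leq_div2l.
rewrite sum_nat_const_nat expnS mul2n -addnn addnK mulnC.
exact: leq_trunc_div.
Qed.

Lemma sum_divn_le x M l : M < 2 ^ l -> \sum_(r < M) x %/ r.+1 <= x * l.
Proof.
move=> lt; apply: leq_trans (sum_divn_dyadic x l).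
rewrite -(big_mkord xpredT (fun r => x %/ r.+1)).
have -> : \sum_(0 <= r < M) x %/ r.+1 = \sum_(1 <= r < M.+1) x %/ r.
  by rewrite big_add1.
by rewrite [leqRHS](@big_cat_nat _ _ _ M.+1) //= leq_addr.
Qed.

Lemma sum_ltn_ord M q : q <= M -> \sum_(r < M) (r < q) = q.
Proof.
move=> le; rewrite -[RHS]card_ord -sum1_card (big_ord_widen M (fun=> 1)) //.
by rewrite [RHS]big_mkcond; apply: eq_bigr => r _; case: ltnP.
Qed.

(** W <= y / r amounts to r <= y / W, and [y <= W * M] ensures that all these r are within range. *)
Lemma sum_budgetE M W y : 0 < W -> y <= W * M ->
  \sum_(r < M) (W <= y %/ r.+1) = y %/ W.
Proof.
move=> W0 le; rewrite -[RHS](@sum_ltn_ord M); last first.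
  by rewrite -(mulKn M W0) leq_div2r.
by apply: eq_bigr => r _; rewrite !leq_divRL // mulnC.
Qed.

Section Components.
Variables (n : nat) (G : sgraph n).
Local Notation e := (edge G).
Implicit Types u v x y : 'I_n.

Definition component u : {set 'I_n} :=
  [set x | fingraph.root e x == fingraph.root e u].

Lemma edge_connect_sym : connect_sym e.
Proof. exact: sym_connect_sym (edge_sym G). Qed.
Local Notation csym := edge_connect_sym.

Lemma component_refl u : u \in component u.
Proof. by rewrite inE. Qed.

Lemma component_closed u x y : x \in component u -> e x y -> y \in component u.
Proof.
rewrite !inE => /eqP <- exy; rewrite eq_sym root_connect ?connect1 //.
exact: csym.
Qed.

Lemma component_proper u : ~ connected G -> #|component u| < n.
Proof.
move=> nconn; rewrite -[X in _ < X]card_ord ltn_neqAle max_card andbT.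
apply/negP => /eqP full; apply: nconn => x y.
have all_in z : z \in component u.
  have /setP /(_ z) : component u = setT.
    by apply/eqP; rewrite eqEcard subsetT cardsT full leqnn.
  by rewrite [in RHS]inE => ->.
rewrite -(root_connect csym); have := all_in x; have := all_in y.
by rewrite !inE => /eqP -> /eqP ->.
Qed.

Definition components_num : nat := #|[set x in roots e]|.

Lemma sum_components (F : 'I_n -> nat) :
  \sum_u F u = \sum_(r in roots e) \sum_(u in component r) F u.
Proof.
rewrite (partition_big (fingraph.root e) (mem (roots e))) => [|u _]; last first.
  exact: (roots_root csym).
apply: eq_bigr => r /eqP rr; apply: eq_bigl => u.
by rewrite !inE /= rr.
Qed.

Lemma component_root u r : u \in component r -> component u = component r.
Proof. by rewrite inE => /eqP ur; apply/setP => x; rewrite !inE ur. Qed.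

(** The ratios F u / W add up to 1 over C; rounding down M times each of them loses at most 1 per
    vertex. *)
Lemma sum_quotients_component (C : {set 'I_n}) (F : 'I_n -> nat) M :
  0 < \sum_(x in C) F x ->
  M <= \sum_(u in C) (F u * M %/ \sum_(x in C) F x) + #|C|.
Proof.
set W := \sum_(x in C) F x => W0.
rewrite -(leq_pmul2r W0) -sum1_card -big_split /= big_distrl /=.
rewrite mulnC big_distrl /=; apply: leq_sum => u _.
by rewrite addn1 ltnW // ltn_ceil.
Qed.

Lemma sum_quotients_ge (F : 'I_n -> nat) M : (forall u, 0 < F u) ->
  M * components_num
  <= \sum_u (F u * M %/ \sum_(x in component u) F x) + n.
Proof.
move=> F0; rewrite -[X in _ + X]card_ord -sum1_card sum_components.
rewrite [X in _ + X]sum_components -big_split /=.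
rewrite mulnC /components_num -sum1_card big_distrl /=.
rewrite (eq_bigl (mem (roots e))); last first.
  by move=> x; rewrite inE.
apply: leq_sum => r _; rewrite mul1n sum1_card.
have Wr0 : 0 < \sum_(x in component r) F x.
  by rewrite (bigD1 r) ?component_refl //= (leq_trans (F0 r)) // leq_addr.
apply: leq_trans (sum_quotients_component M Wr0) _.
by rewrite leq_add2r leq_sum // => u ur; rewrite (component_root ur).
Qed.

Lemma components_num_gt0 : 0 < n -> 0 < components_num.
Proof.
move=> n0; apply/card_gt0P; exists (fingraph.root e (Ordinal n0)).
by rewrite inE; exact: (roots_root csym).
Qed.

Lemma edge_setP u v : (e u v : Prop) -> [set u; v] \in edge_set G.
Proof. by move=> euv; apply/imset2P; exists u v; rewrite ?inE. Qed.

Lemma sum_degrees_le : \sum_u #|[set v | e u v]| <= 2 * #|edge_set G|.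
Proof.
(* An asymmetric relation orients an edge in at most one way, so oriented pairs inject into the edge
   set. Both orders of the vertices together give all ordered pairs. *)
have half (lt : rel 'I_n) : (forall u v, lt u v -> ~~ lt v u) ->
    \sum_u #|[set v | e u v & lt u v]| <= #|edge_set G|.
  move=> asym; pose P := [set p : 'I_n * 'I_n | e p.1 p.2 && lt p.1 p.2].
  have -> : \sum_u #|[set v | e u v & lt u v]| = #|P|.
    rewrite -sum1_card (eq_bigl (fun p : 'I_n * 'I_n =>
      true && (e p.1 p.2 && lt p.1 p.2))); last first.
      by move=> p; rewrite inE.
    rewrite -(pair_big_dep xpredT (fun u v => e u v && lt u v)
      (fun _ _ => 1)) /=.
    apply: eq_bigr => u _; rewrite -sum1_card.
    by apply: eq_bigl => v; rewrite inE.
  rewrite -(card_in_imset (f := fun p => [set p.1; p.2]) (D := P)).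
    apply/subset_leq_card/subsetP => s /imsetP[p].
    rewrite inE => /andP[ep _] ->.
    exact: edge_setP.
  move=> [u v] [u' v']; rewrite !inE /= => /andP[euv luv] /andP[_ luv'] eqs.
  have := set21 u v; have := set22 u v; rewrite eqs !inE.
  have uv : u != v by apply/eqP => uv; move: euv; rewrite uv (edge_irr G).
  move=> /orP[]/eqP vE /orP[]/eqP uE.
  - by move: uv; rewrite uE vE eqxx.
  - by move: (asym _ _ luv'); rewrite -uE -vE luv.
  - by rewrite uE vE.
  - by move: uv; rewrite uE vE eqxx.
have le1 := half (fun u v => u < v) _; have le2 := half (fun u v => v < u) _.
rewrite mul2n -addnn; apply: leq_trans (leq_add (le1 _) (le2 _)).
- rewrite -big_split leq_sum // => u _ /=; rewrite -cardsUI.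
  apply: leq_trans (leq_addr _ _); apply/subset_leq_card/subsetP => v.
  rewrite !inE => euv; rewrite euv /= -neq_ltn; apply/eqP => /val_inj uv.
  by move: euv; rewrite uv (edge_irr G).
- by move=> u v; lia.
- by move=> u v; lia.
Qed.

Lemma isolated_root u : #|[set v | e u v]| = 0 -> u \in roots e.
Proof.
move=> /cards0_eq iso; rewrite inE.
have /connectP[[|v p] /= up rE] := connect_root e u.
  exact/eqP.
by have /setP/(_ v) := iso; move: up; rewrite !inE => /andP[-> _].
Qed.

(** Weight exceeds degree only at isolated vertices, by 1, and each of these is the root of its own
    component. *)
Lemma sum_weights_le (adj : 'I_n -> seq 'I_n) : adjacency_lists G adj ->
  \sum_u weight adj u <= 2 * #|edge_set G| + components_num.
Proof.
move=> adjG; have szE u : size (adj u) = #|[set v | e u v]|.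
  have [ua ae] := adjG u; rewrite -(card_uniqP ua); apply: eq_card => v.
  by rewrite inE ae.
apply: leq_trans (leq_add sum_degrees_le (leqnn _)).
rewrite /components_num -sum1_card (big_mkcond (fun u => u \in _)) -big_split.
apply: leq_sum => u _ /=; rewrite /weight szE.
case: (posnP #|[set v | e u v]|) => [iso|pos]; last first.
  by rewrite (maxn_idPr pos) leq_addr.
by rewrite iso inE isolated_root.
Qed.

Section Joined.
Variable r0 : 'I_n.

(** A star on the component roots, centred at the root of [r0]: it connects the graph with one new
    edge per remaining component. *)
Definition star_edge : rel 'I_n := fun u v =>
  [&& u != v, u \in roots e, v \in roots e
    & (u == fingraph.root e r0) || (v == fingraph.root e r0)].

Definition join_edge : rel 'I_n := fun u v => e u v || star_edge u v.

Lemma join_edge_sym : symmetric join_edge.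
Proof.
move=> u v; rewrite /join_edge /star_edge (edge_sym G) [v == u]eq_sym.
by congr orb; congr andb; rewrite andbCA [(u == _) || _]orbC.
Qed.

Lemma join_edge_irr : irreflexive join_edge.
Proof. by move=> u; rewrite /join_edge /star_edge (edge_irr G) eqxx. Qed.

Definition joined : sgraph n := SGraph join_edge_sym join_edge_irr.

Lemma joined_connected : connected joined.
Proof.
have jsym := sym_connect_sym join_edge_sym.
have to_root u : connect join_edge u (fingraph.root e u).
  apply: connect_sub (connect_root e u) => x y exy.
  by apply: connect1; rewrite /join_edge exy.
have to_r0 u : connect join_edge u (fingraph.root e r0).
  apply: connect_trans (to_root u) _.
  case: (fingraph.root e u =P fingraph.root e r0) => [->//|/eqP ne].
  apply: connect1; rewrite /join_edge /star_edge ne eqxx !orbT.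
  by rewrite -![_ \in _]/(roots e _) !(roots_root csym) orbT.
by move=> u v; apply: connect_trans (to_r0 u) _; rewrite jsym.
Qed.

Lemma edge_dist_joined : edge_dist G joined <= components_num.-1.
Proof.
set Rts := [set x in roots e]; set rt := fingraph.root e r0.
have rtR : rt \in Rts by rewrite inE; exact: (roots_root csym).
have -> : components_num.-1 = #|Rts :\ rt|.
  by rewrite /components_num (cardsD1 rt) rtR.
apply: leq_trans (leq_imset_card (fun r => [set rt; r]) _).
apply/subset_leq_card/subsetP => s; rewrite !inE.
case/orP=> /andP[sN /imset2P[u v _]]; rewrite inE => /andP[_ uv] sE.
  case/negP: sN; rewrite sE; apply/imset2P.
  by exists u v; rewrite // inE /= /join_edge uv.
move: uv; rewrite /= /join_edge => /orP[euv|].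
  by case/negP: sN; rewrite sE; exact: edge_setP.
case/and4P=> ne ru rv /orP[/eqP E|/eqP E]; apply/imsetP.
  by exists v; [rewrite !inE /rt -E eq_sym ne|rewrite sE E].
by exists u; [rewrite !inE /rt -E ne|rewrite sE E setUC].
Qed.
End Joined.

Local Open Scope ring_scope.

Lemma far_edges_le (R : realType) (eps : R) (k : nat) :
  (0 < n)%N -> 0 < eps -> eps^-1 <= k%:R -> far_from_connected eps G ->
  (#|edge_set G| <= k * components_num.-1)%N.
Proof.
move=> n0 eps0 epsk far; have := far _ (joined_connected (Ordinal n0)).
set m := #|_| => le; have {le} : eps * m%:R <= (components_num.-1)%:R.
  by apply: le_trans le _; rewrite ler_nat edge_dist_joined.
rewrite mulrC -ler_pdivlMr // => le; rewrite -(ler_nat R) natrM mulrC.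
by apply: le_trans le _; rewrite ler_wpM2l.
Qed.

(** A connected graph is at distance 0 from itself, so being far would leave it without edges, which
    is impossible on two vertices or more. *)
Lemma far_not_connected (R : realType) (eps : R) :
  (1 < n)%N -> 0 < eps -> far_from_connected eps G -> ~ connected G.
Proof.
move=> n1 eps0 far conn; have := far G conn.
rewrite /edge_dist setDv setU0 cards0 pmulr_rle0 // lern0 cards_eq0.
move=> /eqP noedge.
have /connectP[[|v p] /= up E] := conn (Ordinal (ltnW n1)) (Ordinal n1).
  by move/(congr1 val): E.
by move: up => /andP[/edge_setP]; rewrite noedge inE.
Qed.

Lemma far_weights_le (R : realType) (eps : R) (k : nat) adj :
  (0 < n)%N -> 0 < eps -> eps^-1 <= k%:R -> (0 < k)%N ->
  adjacency_lists G adj -> far_from_connected eps G ->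
  (\sum_u weight adj u <= 3 * components_num * k)%N.
Proof.
move=> n0 eps0 epsk k0 adjG /(far_edges_le n0 eps0 epsk) mk.
apply: leq_trans (sum_weights_le adjG) _; have := components_num_gt0 n0.
case: components_num mk => // c /= mk _; nia.
Qed.

End Components.

End Combinatorics.


(** * The tester *)

Definition bits (y : nat) : nat := if y is 0 then 0 else (trunc_log 2 y).+1.

Lemma bits_half y : (0 < y)%N -> bits y = (bits (y %/ 2)).+1.
Proof.
case: y => // -[|y] _ //; rewrite divn2.
rewrite {1}/bits trunc_log2S //.
Qed.

Lemma ltn_bits y : (y < 2 ^ bits y)%N.
Proof. by case: y => // y; apply: trunc_log_ltn. Qed.

Lemma expn_bits_le y : (0 < y)%N -> (2 ^ (bits y).-1 <= y)%N.
Proof. by case: y => // y _; apply: trunc_logP. Qed.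

Lemma bits_le y : (bits y <= y)%N.
Proof.
case: (posnP y) => [->//|y0]; have := expn_bits_le y0.
have := ltn_expl (bits y).-1 (ltnSn 1); lia.
Qed.

Section Prelude.
Variables (w n : nat) (adj : 'I_n -> seq 'I_n) (R : realType) (E : pred config).

(** A halving takes 4 steps: the test, the sequencing and two operations. The last test accounts for
    the successor of [t0]. *)
Lemma prob_ge_bits t0 (x : R) k m q y a :
  m 12%N = y -> m 11%N = 2%N -> m 14%N = 1%N -> m 18%N = a ->
  (y < 2 ^ w)%N -> (a + bits y < 2 ^ w)%N ->
  (forall m', (forall b, b != 12%N -> b != 18%N -> m' b = m b) ->
     m' 18%N = (a + bits y)%N -> prob_ge w adj E t0 x (Config k m' q)) ->
  prob_ge w adj E (4 * bits y + t0.+1) x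
    (Config (While 12 (Op Quo 12 12 11 ;; Op Plus 18 18 14) :: k) m q).
Proof.
move: {2}(bits y) (erefl (bits y)) => l lE.
elim: l y a m lE => [|l IH] y a m lE m12 m11 m14 m18 yw aw next.
  have y0 : y = 0%N by case: y lE {m12 yw aw next}.
  rewrite lE; apply: (prob_ge_while m12); rewrite y0 /=.
  by apply: next => //; rewrite m18 lE addn0.
have y0 : (0 < y)%N by case: y lE {m12 yw aw next}.
have half := bits_half y0; have divw : (y %/ 2 <= y)%N by exact: leq_div.
apply: (@prob_geW _ _ _ _ _ (3 + (4 * bits (y %/ 2) + t0.+1)).+1%N _ x) => //.
  by rewrite half; lia.
apply: (prob_ge_while m12); rewrite -lt0n y0.
op (y %/ 2)%N.
op a.+1.
apply: (IH (y %/ 2)%N a.+1) => //; try lia.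
move=> m' same m'18; apply: next => [b b12 b18|]; last by rewrite m'18; lia.
by rewrite same // /upd (negPf b12) (negPf b18).
Qed.

Variable eps : R.
Local Notation k := (inv_ceil eps).
Local Notation l := (bits (6 * k)).
Local Notation T0 := (72 * k * l)%N.

Lemma tester_ge (x : R) : (0 < n)%N -> (0 < k)%N ->
  (T0 < 2 ^ w)%N -> (32 + (n + n) < 2 ^ w)%N ->
  loop_ge w adj (6 * k) T0 E T0 (Idle n) x ->
  prob_ge w adj E (30 + 4 * l + 40 * T0) x (init n eps tester).
Proof.
move=> n0 k0 T0w addrw loop.
have l0 : (0 < l)%N by rewrite bits_half; lia.
have kT0 : (72 * k <= T0)%N by rewrite leq_pmulr.
have l6 : (l <= 6 * k)%N := bits_le (6 * k).
rewrite /init /tester /prelude; set m0 := fun a => _.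
apply: (@prob_geW _ _ _ _ _
  (18 + (4 * l + (10 + (40 * T0).+1).+1))%N _ x) => //.
  by lia.
seqs; apply: (prob_ge_const (v := 1%N)); first lia.
seqs; apply: (prob_ge_const (v := 6%N)); first lia.
op (6 * k)%N.
seqs; apply: (prob_ge_const (v := 2%N)); first lia.
op (6 * k)%N.
seqs.
apply: prob_geW (@prob_ge_bits (10 + (40 * T0).+1)%N x _ _ _
  (6 * k)%N 0%N _ _ _ _ _ _ _) => //.
- by lia.
- by lia.
- by lia.
move=> m same m18.
seqs; apply: (prob_ge_const (v := 72%N)); first lia.
have same' b : b != 12%N -> b != 18%N -> m b = if b == 11%N then 2%N else
  if b == 15%N then (6 * k)%N else if b == 14%N then 1%N else m0 b.
  move=> b12 b18; rewrite same // /upd (negPf b12).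
  by case: ifP => // _; case: (b == 15%N).
op (72 * k)%N; first by rewrite same'.
op (72 * k * l)%N.
seqs; apply: (prob_ge_const (v := 32%N)); first lia.
op (32 + n)%N; first by rewrite same'.
apply: prob_geW (loop _ _ _) => //.
split; [|by mem|by rewrite /upd /= same' // addn0| |by rewrite /= /upd /= same'].
  by split; rewrite /upd /= ?same'.
by move=> u; have un := ltn_ord u; rewrite /upd /=; mem; rewrite !same' //; mem.
Qed.

End Prelude.

(** * Comparison of the running time with the complexity scale *)

Section Scale.
Variables (R : realType) (eps : R).
Hypotheses (eps_gt0 : 0 < eps) (eps_lt1 : eps < 1).
Local Notation k := (inv_ceil eps).
Local Notation l := (bits (6 * k)).

Lemma inv_ceil_ge : eps^-1 <= k%:R.
Proof.
have i0 : 0 < eps^-1 by rewrite invr_gt0.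
rewrite /inv_ceil natr_absz ger0_norm; first exact: ceil_ge.
by rewrite ceil_ge0 (lt_trans _ i0) // ltrN10.
Qed.

Lemma inv_ceil_le : k%:R <= 2 * eps^-1.
Proof.
have i0 : 0 < eps^-1 by rewrite invr_gt0.
have i1 : 1 < eps^-1 by rewrite invf_gt1.
rewrite /inv_ceil natr_absz ger0_norm; last first.
  by rewrite ceil_ge0 (lt_trans _ i0) // ltrN10.
have := ceilB1_lt eps^-1; rewrite intrB; lra.
Qed.

Lemma inv_ceil_gt0 : (0 < k)%N.
Proof.
by rewrite -(ltr0n R); apply: lt_le_trans inv_ceil_ge; rewrite invr_gt0.
Qed.

(** From 2 ^ (l - 1) <= 6 k <= 12 / eps, take logarithms; the maximum with 1 absorbs the
    constants. *)
Lemma bits_scale :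
  l%:R <= (1 + (ln 12 + 1) / ln 2) * Num.max 1 (ln eps^-1) :> R.
Proof.
have i0 : 0 < eps^-1 by rewrite invr_gt0.
have ln2 : 0 < ln 2 :> R by rewrite ln_gt0 // ltr1n.
have ln12 : 0 < ln 12 :> R by rewrite ln_gt0 // ltr1n.
set L := Num.max _ _.
have L1 : 1 <= L by rewrite le_max lexx.
have LL : ln eps^-1 <= L by rewrite le_max lexx orbT.
have k0 := inv_ceil_gt0; have y0 : (0 < 6 * k)%N by lia.
have : (l.-1)%:R * ln 2 <= ln 12 + ln eps^-1 :> R.
  rewrite mulr_natl -lnXn // -lnM ?posrE //.
  rewrite ler_ln ?posrE ?exprn_gt0 ?mulr_gt0 //.
  apply: (@le_trans _ _ (6 * k)%:R); last first.
    by rewrite natrM; have := inv_ceil_le; lra.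
  by rewrite -natrX ler_nat expn_bits_le.
rewrite -ler_pdivlMr // => le.
have -> : l%:R = 1 + (l.-1)%:R :> R.
  by rewrite addrC natr1 prednK // bits_half.
rewrite mulrDl mul1r lerD //; apply: le_trans le _.
rewrite mulrAC ler_pM2r ?invr_gt0 //; nra.
Qed.

Lemma time_scale : (30 + 4 * l + 40 * (72 * k * l))%:R
  <= 6000 * (1 + (ln 12 + 1) / ln 2) * complexity_scale eps.
Proof.
have k0 := inv_ceil_gt0; have l0 : (0 < l)%N by rewrite bits_half; lia.
(* Since k and l are at least 1, the sum is at most (30 + 4 + 2880) k l. The bound k <= 2 / eps then
   doubles 3000 to 6000. *)
apply: (@le_trans _ _ (3000 * (k * l))%:R); first by rewrite ler_nat; nia.
rewrite natrM /complexity_scale natrM.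
have := inv_ceil_le; have := bits_scale.
set a := _ * Num.max _ _ => la ka.
apply: (@le_trans _ _ (3000 * (2 * eps^-1 * a))).
  by rewrite ler_pM2l // ler_pM.
by rewrite le_eqVlt; apply/orP; left; apply/eqP; rewrite /a; ring.
Qed.
End Scale.

Section Tester.
Variables (R : realType) (eps : R) (w n : nat) (G : sgraph n)
  (adj : 'I_n -> seq 'I_n).
Hypotheses (eps_gt0 : 0 < eps) (eps_lt1 : eps < 1).
Hypothesis inst : instance eps 12 w G adj.
Local Notation k := (inv_ceil eps).
Local Notation l := (bits (6 * k)).
Local Notation T0 := (72 * k * l)%N.
Local Notation t := (30 + 4 * l + 40 * T0)%N.

(* All numbers that the program handles are at most 1024 (n + k)^2, hence at
   most (n + k)^12. *)
Lemma word_bounds :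
  [/\ (T0 < 2 ^ w)%N, (n * (6 * k) < 2 ^ w)%N & (32 + (n + n) < 2 ^ w)%N].
Proof.
have [n0 _ le] := inst; have k0 := inv_ceil_gt0 eps_gt0.
have l6 : (l <= 6 * k)%N := bits_le (6 * k).
(* Both n and k are positive, so (n + k) ^ 10 is at least 2 ^ 10. *)
have le' : (1024 * ((n + k) * (n + k)) <= 2 ^ w)%N.
  apply: leq_trans le; rewrite -[12%N]/(10 + 2)%N expnD leq_mul //.
  by apply: (@leq_trans (2 ^ 10)) => //; rewrite leq_exp2r //; lia.
have T1 : (T0 <= 72 * k * (6 * k))%N by rewrite leq_mul2l l6 orbT.
by split; apply: leq_trans le'; nia.
Qed.

Lemma adj_uniq v : uniq (adj v).
Proof. by have [_ /(_ v) []] := inst. Qed.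

Lemma adjE u v : (v \in adj u) = edge G u v.
Proof. by have [_ /(_ u) [_ ->]] := inst. Qed.

Lemma tester_halts : prob_ge w adj halted t (1 : R) (init n eps tester).
Proof.
have [n0 _ _] := inst; have [b1 b2 b3] := word_bounds.
have k0 := inv_ceil_gt0 eps_gt0.
by apply: tester_ge => //; apply: loop_halts => //; [exact: adj_uniq|lia].
Qed.

Lemma tester_accepts : connected G ->
  prob_ge w adj accepts t (1 : R) (init n eps tester).
Proof.
move=> conn.
have [n0 _ _] := inst; have [b1 b2 b3] := word_bounds.
have k0 := inv_ceil_gt0 eps_gt0.
apply: tester_ge => //; apply: loop_accepts => //; first exact: adj_uniq.
  by lia.
move=> [|z Q] // _ closedQ u.
have cl : closed (edge G) [in z :: Q].
  move=> x y exy; apply/idP/idP => /closedQ; apply; rewrite adjE //.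
  by rewrite edge_sym.
by have := closed_connect cl (conn z u); rewrite !inE eqxx /= => <-.
Qed.

Lemma tester_rejects : (1 < n)%N -> far_from_connected eps G ->
  prob_ge w adj rejects t (2 / 3 : R) (init n eps tester).
Proof.
move=> n1 far.
have [n0 adjG _] := inst; have [b1 b2 b3] := word_bounds.
have k0 := inv_ceil_gt0 eps_gt0; have l0 : (0 < l)%N by rewrite bits_half; lia.
have W3 := far_weights_le n0 eps_gt0 (inv_ceil_ge eps_gt0) k0 adjG far.
have nconn := far_not_connected n1 eps_gt0 far.
apply: tester_ge => //.
(* Take D = 24 k l, a third of [T0]. *)
have -> : 2 / 3 = markov R (24 * k * l) T0.
  rewrite markovE; last by nia.
  have -> : (72 * k * l = 3 * (24 * k * l))%N by nia.
  rewrite (natrM _ 3); have : (24 * k * l)%:R != 0 :> R by rewrite pnatr_eq0; nia.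
  by move=> a0; rewrite invfM mulrCA mulfV // mulr1; lra.
apply: (@loop_rejects w n adj adj_uniq (6 * k) T0 _ _ _ _ _ R
  (component G)) => //.
- by lia.
- exact: component_refl.
- by move=> u x y xu; rewrite adjE; exact: component_closed.
- by move=> u; exact: component_proper.
set c := components_num G in W3.
have w0 u : (0 < weight adj u)%N by rewrite leq_max.
have nW : (n <= \sum_u weight adj u)%N.
  by rewrite -[X in (X <= _)%N]card_ord -sum1_card leq_sum.
have budgets : (\sum_u \sum_(r < 6 * k) weight adj u * (6 * k) %/ r.+1
    <= (\sum_u weight adj u) * (6 * k) * l)%N.
  rewrite -mulnA big_distrl /=; apply: leq_sum => u _; rewrite [leqRHS]mulnA.
  by apply: sum_divn_le; exact: ltn_bits.
have successes : (6 * k * c <= \sum_u \sum_(r < 6 * k)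
    (\sum_(x in component G u) weight adj x
       <= weight adj u * (6 * k) %/ r.+1) + n)%N.
  apply: leq_trans (sum_quotients_ge G _ w0) _.
  rewrite leq_add2r; apply: leq_sum => u _; rewrite sum_budgetE //.
    by rewrite (bigD1 u) ?component_refl //= (leq_trans (w0 u)) // leq_addr.
  by rewrite leq_mul2r (bigD1 u) ?component_refl //= leq_addr orbT.
move: budgets successes nW W3.
set A := (\sum_u \sum_r _)%N; set W := (\sum_u weight _ _)%N.
set B := (\sum_u \sum_r _)%N; rewrite -/c => HA HB HW W3.
(* Rounding costs n <= W <= 3 k c out of 6 k c. The factor 6 in M is chosen so that half of the
   successes survive. *)
have HB' : (3 * (k * c) <= B)%N by lia.
have HA' : (A <= 3 * c * k * (6 * k) * l)%N.
  by apply: leq_trans HA _; rewrite !leq_mul2r W3 !orbT.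
have Hn : (n * (6 * k) <= 3 * c * k * (6 * k) * l)%N.
  rewrite -(muln1 (n * (6 * k))%N) leq_mul // leq_mul2r.
  by rewrite (leq_trans HW W3) orbT.
apply: (@leq_trans (24 * k * l * (3 * (k * c)))%N); last first.
  by rewrite leq_mul2l HB' orbT.
(* Both 2 A and 2 n M are at most twice 18 c k^2 l, and 72 c k^2 l is 24 k l times 3 k c. *)
apply: (@leq_trans (4 * (3 * c * k * (6 * k) * l))%N); first by lia.
by apply/eq_leq; ring.
Qed.
End Tester.

Theorem theoremA1 (R : realType) :
  exists (P : cmd) (C : R) (K : nat),
    forall eps : R, 0 < eps -> eps < 1 ->
    exists t q : nat,
      [/\ is_tester eps K P t /\ one_sided eps K P t,
          time_complexity eps K P t,
          query_complexity eps K P q,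
          t%:R <= C * complexity_scale eps
        & q%:R <= C * complexity_scale eps].
Proof.
exists tester, (6000 * (1 + (ln 12 + 1) / ln 2)), 12%N => eps eps0 eps1.
set l := bits (6 * inv_ceil eps).
set t := (30 + 4 * l + 40 * (72 * inv_ceil eps * l))%N.
have halts w n (G : sgraph n) adj : instance eps 12 w G adj ->
    all halted (outcomes w adj t (init n eps tester)).
  move=> inst; apply: (@prob_ge1_all _ _ _ R).
  exact: (tester_halts eps0 eps1 inst (leqnn t)).
have one w n (G : sgraph n) adj : instance eps 12 w G adj -> connected G ->
    prob w adj R t accepts (init n eps tester) = 1.
  move=> inst conn; apply/eqP; rewrite eq_le prob_le1.
  exact: (tester_accepts eps0 eps1 inst conn (leqnn t)).
(* A query takes a step, so the time bound also bounds the queries. *)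
exists t, t; split; try exact: time_scale.
- split=> [w n G adj inst|]; last exact: one.
  split=> [conn|n1 far]; first by rewrite (one _ _ _ _ inst conn); lra.
  exact: (tester_rejects eps0 eps1 inst n1 far (leqnn t)).
- exact: halts.
- by move=> w n G adj inst t'; have := halting_queries (halts _ _ _ _ inst) t'.
Qed.
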